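(* Let $f,g,h\colon\mathbb{R}^2\to\mathbb{R}$ be continuous functions. Let $F,\tilde F\subseteq\mathbb{R}^2\times\mathbb{R}^2$ be convex sets such that $f(\mathbf u)+g(\mathbf v)=h(\mathbf u+\mathbf v)$ for all $(\mathbf u,\mathbf v)\in F\cup\tilde F$. Suppose that $\mathtt p_3(F)=\mathtt p_3(\tilde F)$ and that this set is full-dimensional in $\mathbb{R}^2$. Suppose furthermore that there are vectors $\mathbf u^i,\mathbf d^i,\tilde{\mathbf u}^i,\tilde{\mathbf d}^i\in\mathbb{R}^2$ ($i=1,2$) such that $$\mathtt p_i(F)=\{\mathbf u^i+\lambda_i\mathbf d^i:\lambda_i\in[0,1]\}\quad\text{and}\quad \mathtt p_i(\tilde F)=\{\tilde{\mathbf u}^i+\tilde\lambda_i\tilde{\mathbf d}^i:\tilde\lambda_i\in[0,1]\}\qquad\text{for } i=1,2,$$ with $\mathbf d^1=\tilde{\mathbf d}^1$ (so $\mathtt p_1(F)$ and $\mathtt p_1(\tilde F)$ are translates of each other), and that each of the pairs $(\mathbf d^1,\mathbf d^2)$, $(\mathbf d^1,\tilde{\mathbf d}^2)$, and $(\mathbf d^2,\tilde{\mathbf d}^2)$ is linearly independent. Then there exists a vector $\mathbf c\in\mathbb{R}^2$ such that, with respect to the linear space $L=\operatorname{span}(\mathbf d^1)$, $f$ is affine with gradient $\mathbf c$ over $\mathtt p_1(F)$ and over $\mathtt p_1(\tilde F)$, $g$ is affine with gradient $\mathbf c$ over $\mathtt p_2(F)$ and over $\mathtt p_2(\tilde F)$,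 and $h$ is affine with gradient $\mathbf c$ over $\mathtt p_3(F)$ and over $\mathtt p_3(\tilde F)$.
   Context: The maps $\mathtt p_1,\mathtt p_2,\mathtt p_3\colon\mathbb{R}^2\times\mathbb{R}^2\to\mathbb{R}^2$ are defined by $\mathtt p_1(\mathbf x^1,\mathbf x^2)=\mathbf x^1$, $\mathtt p_2(\mathbf x^1,\mathbf x^2)=\mathbf x^2$, $\mathtt p_3(\mathbf x^1,\mathbf x^2)=\mathbf x^1+\mathbf x^2$. Given a linear subspace $L\subseteq\mathbb{R}^2$ and a set $U\subseteq\mathbb{R}^2$, a function $\phi$ is affine with respect to $L$ over $U$ with gradient $\mathbf c\in\mathbb{R}^2$ if $\phi(\mathbf w^2)-\phi(\mathbf w^1)=\mathbf c\cdot(\mathbf w^2-\mathbf w^1)$ for all $\mathbf w^1,\mathbf w^2\in U$ with $\mathbf w^2-\mathbf w^1\in L$. *)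

(* Defs.v *)
From HB Require Import structures.
From mathcomp Require Import all_boot all_order all_algebra.
From mathcomp Require Import all_classical all_reals all_analysis.

Set Implicit Arguments.
Unset Strict Implicit.
Unset Printing Implicit Defensive.

Import Order.TTheory GRing.Theory Num.Theory numFieldNormedType.Exports.

Local Open Scope classical_set_scope.
Local Open Scope ring_scope.

Definition p1 (R : realType) (x : 'rV[R]_2 * 'rV[R]_2) : 'rV[R]_2 := x.1.
Definition p2 (R : realType) (x : 'rV[R]_2 * 'rV[R]_2) : 'rV[R]_2 := x.2.
Definition p3 (R : realType) (x : 'rV[R]_2 * 'rV[R]_2) : 'rV[R]_2 :=
  x.1 + x.2.

Definition dotv (R : realType) (u v : 'rV[R]_2) : R :=
  \sum_(i < 2) u 0 i * v 0 i.

Definition affine_wrt (R : realType) (L : {vspace 'rV[R]_2})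
    (U : set 'rV[R]_2) (phi : 'rV[R]_2 -> R) (c : 'rV[R]_2) : Prop :=
  forall w1 w2 : 'rV[R]_2, U w1 -> U w2 -> w2 - w1 \in L ->
    phi w2 - phi w1 = dotv c (w2 - w1).

(* The case d = 0 is allowed and gives a single point. *)
Definition param_segment (R : realType) (u d : 'rV[R]_2) : set 'rV[R]_2 :=
  [set u + l *: d | l in [set l : R | 0 <= l <= 1]].

Definition affine_hull (R : realType) (A : set 'rV[R]_2) : set 'rV[R]_2 :=
  [set x | exists (n : nat) (a : 'I_n -> R) (v : 'I_n -> 'rV[R]_2),
     [/\ forall i, A (v i), \sum_(i < n) a i = 1
       & x = \sum_(i < n) a i *: v i]].

(* The dimension of a set is that of its affine hull, and the only
   two-dimensional affine subspace of the plane is the plane itself. *)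
Definition full_dimensional (R : realType) (A : set 'rV[R]_2) : Prop :=
  affine_hull A = setT.

(* Main.v *)
Require Import Defs.
From HB Require Import structures.
From mathcomp Require Import all_boot all_order all_algebra.
From mathcomp Require Import all_classical all_reals all_analysis.
From mathcomp Require Import ring lra.

Set Implicit Arguments.
Unset Strict Implicit.
Unset Printing Implicit Defensive.

Import Order.TTheory GRing.Theory Num.Theory numFieldNormedType.Exports.

Local Open Scope classical_set_scope.
Local Open Scope ring_scope.

(** The projection of a point of the sum set [P := p3 F = p3 Ft] on its first
    summand in [F] (resp. in [Ft]) is well defined, since [d1] is independent
    of [d2] (resp. of [dt2]). Moving the point of [P] by [s *: d1] adds
    [s *: d1] to both first summands [u], [ut] and fixes both second summands,
    so additivity gives
    [f (u + s *: d1) - f u = f (ut + s *: d1) - f ut], a difference of [h]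
    ([first_difference_transfer]). Moving the point along [dt2] instead fixes
    [ut] but changes [u], because [dt2] is not parallel to [d2]. Hence the
    first difference of [f] with step [s *: d1] is locally independent of [u],
    that is, the symmetric second differences of [f] along the first segment
    vanish locally ([second_difference_eq0]). This needs room around a point
    of [P], which convexity and full dimension provide over every interior
    point of the segment ([exists_interior_over]).

    A continuous function of one variable with locally vanishing symmetric
    second differences is affine, by a maximum principle
    ([affine_of_locally_vanishing_second_difference]). So [f] is affine on
    [p1 F] and, exchanging [F] and [Ft], on [p1 Ft]; the equality of first
    differences makes the two slopes [k] equal ([slopes_agree]). Any [c] with
    [dotv c d1 = k] then serves for [f], [g] and [h]
    ([affine_wrt_summands]). *)

(** * A one-variable maximum principle *)

(** Maximum principle. After the chord is subtracted, [phi] becomes a function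
    [psi] with [psi a = psi b = 0]. For [eta > 0], the function
    [psi y - eta * ((y - a) * (b - y))] has small symmetric second differences
    [2 * eta * s ^+ 2 > 0] at every interior point, so its maximum is attained
    at an endpoint and is [0]. Letting [eta] tend to [0] gives [psi <= 0]; the
    same bound for [- psi] gives [psi = 0]. *)
Lemma affine_of_locally_vanishing_second_difference (R : realType)
    (phi : R -> R) (a b : R) :
  a < b -> continuous phi ->
  (forall x, a < x < b ->
     \forall s \near (0 : R), phi (x + s) + phi (x - s) = 2 * phi x) ->
  forall x, a <= x <= b ->
    phi x = phi a + (phi b - phi a) / (b - a) * (x - a).
Proof.
move=> ab.
have bound : forall psi : R -> R, continuous psi ->
    psi a = 0 -> psi b = 0 ->
    (forall x, a < x < b ->
       \forall s \near (0 : R), psi (x + s) + psi (x - s) = 2 * psi x) ->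
    forall x, a <= x <= b -> psi x <= 0.
  move=> psi cpsi psia psib psiE x xab.
  apply/ler_addgt0Pr => e e0; rewrite add0r.
  (* [(y - a) * (b - y)] is at most [(b - a) ^+ 2], so this [eta] costs
     at most [e] *)
  pose eta := e / (b - a) ^+ 2.
  have ba2 : 0 < (b - a) ^+ 2 by rewrite exprn_gt0// subr_gt0.
  have eta0 : 0 < eta by rewrite divr_gt0.
  have etaE : eta * (b - a) ^+ 2 = e by rewrite /eta mulfVK// gt_eqF.
  pose q y : R := psi y - eta * ((y - a) * (b - y)).
  have cq : continuous q.
    move=> y; apply: cvgB; first exact: cpsi.
    apply: cvgM; first exact: cvg_cst.
    by apply: cvgM; apply: cvgB; (exact: cvg_id || exact: cvg_cst).
  have [m mab qmax] := EVT_max (ltW ab) (continuous_subspaceT cq).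
  have qm : q m <= 0.
    move: mab; rewrite in_itv /= => /andP[am mb].
    have [->|ma] := eqVneq m a; first by rewrite /q psia subrr mul0r mulr0 subr0.
    have [->|mb'] := eqVneq m b; first by rewrite /q psib subrr !mulr0 subr0.
    have {}am : a < m by rewrite lt_neqAle eq_sym ma.
    have {}mb : m < b by rewrite lt_neqAle mb'.
    exfalso.
    have near_s : \forall s \near (0 : R)^'+, False.
      near=> s.
      have s0 : 0 < s by [].
      have psis : psi (m + s) + psi (m - s) = 2 * psi m.
        near: s; apply: cvg_within; apply: psiE; exact/andP.
      have sa : s < m - a by near: s; apply: nbhs_right_lt; rewrite subr_gt0.
      have sb : s < b - m by near: s; apply: nbhs_right_lt; rewrite subr_gt0.
      have /qmax : m + s \in `[a, b] by rewrite in_itv /=; apply/andP; split; lra.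
      have /qmax : m - s \in `[a, b] by rewrite in_itv /=; apply/andP; split; lra.
      rewrite /q.
      (* the values at [m + s] and [m - s] add up to twice the maximum plus
         [2 * eta * s ^+ 2] *)
      have : 0 < eta * s ^+ 2 by rewrite mulr_gt0// exprn_gt0.
      nra.
    by have [] := filter_ex near_s.
  have /qmax : x \in `[a, b] by rewrite in_itv.
  move=> /le_trans /(_ qm); rewrite /q subr_le0 => /le_trans; apply.
  rewrite -etaE ler_pM2l//.
  move: xab => /andP[? ?]; nra.
move=> cphi phiE x xab.
pose k := (phi b - phi a) / (b - a).
pose psi y : R := phi y - phi a - k * (y - a).
have cpsi : continuous psi.
  move=> y; apply: cvgB.
    by apply: cvgB; [exact: cphi | exact: cvg_cst].
  by apply: cvgM; [|apply: cvgB]; (exact: cvg_id || exact: cvg_cst).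
have psia : psi a = 0 by rewrite /psi !subrr mulr0 subrr.
have psib : psi b = 0.
  by rewrite /psi /k divfK ?subrr// subr_eq0 gt_eqF.
have psiE : forall x, a < x < b ->
    \forall s \near (0 : R), psi (x + s) + psi (x - s) = 2 * psi x.
  move=> y yab; near=> s.
  have : phi (y + s) + phi (y - s) = 2 * phi y by near: s; exact: phiE.
  rewrite /psi; lra.
have le1 := bound psi cpsi psia psib psiE x xab.
have : - psi x <= 0.
  apply: (bound (fun y => - psi y)) xab.
  - by move=> y; apply: cvgN; exact: cpsi.
  - by rewrite psia oppr0.
  - by rewrite psib oppr0.
  - move=> y yab; near=> s.
    have : psi (y + s) + psi (y - s) = 2 * psi y by near: s; exact: psiE.
    lra.
by rewrite /psi -/k in le1 *; lra.
Unshelve. all: by end_near.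
Qed.

(** * Lines, triangles and convex sets in the plane *)

Lemma exists_notin_vline (R : realType) (v : 'rV[R]_2) :
  exists w, w \notin <[v]>%VS.
Proof.
apply: contrapT => /forallNP H.
have : (fullv <= <[v]>)%VS.
  by apply/subvP => w _; apply: contrapT => /negP /H.
move/dimvS; rewrite dimvf dim_matrix dim_vline.
by case: (v != 0).
Qed.

Lemma free_pair (R : realType) (a b : 'rV[R]_2) :
  free [:: a; b] = (a \notin <[b]>%VS) && (b != 0).
Proof. by rewrite free_cons span_seq1 seq1_free. Qed.

Lemma free_pair_eq0 (R : realType) (a b : 'rV[R]_2) (i j : R) :
  free [:: a; b] -> i *: a + j *: b = 0 -> i = 0 /\ j = 0.
Proof.
rewrite free_pair => /andP[ab b0] E.
have i0 : i = 0.
  apply: contraNeq ab => i0; apply/vlineP; exists (- (i^-1 * j)).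
  apply: (scalerI i0); rewrite scalerA mulrN mulrA divff// mul1r scaleNr.
  by apply/eqP; rewrite -addr_eq0 E.
split=> //; move: E; rewrite i0 scale0r add0r => /eqP.
by rewrite scaler_eq0 (negPf b0) orbF => /eqP.
Qed.

Lemma free_pair_span (R : realType) (a b v : 'rV[R]_2) :
  free [:: a; b] -> exists i j, v = i *: a + j *: b.
Proof.
move=> ab.
have : basis_of fullv [:: a; b].
  by rewrite basisEfree ab subvf dimvf dim_matrix.
move=> /span_basis Hs.
have : v \in <<[:: a; b]>>%VS by rewrite Hs memvf.
rewrite span_cons span_seq1 => /memv_addP[x /vlineP[i ->]] [y /vlineP[j ->] ->].
by exists i, j.
Qed.

(** A line of the plane contains all the affine combinations of its points and
    is not the whole plane. *)
Lemma full_dimensional_escapes_line (R : realType) (A : set 'rV[R]_2) p v :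
  full_dimensional A -> exists2 r, A r & r - p \notin <[v]>%VS.
Proof.
move=> fullA; apply: contrapT => H.
have inA r : A r -> r - p \in <[v]>%VS.
  by move=> Ar; apply: contrapT => /negP rv; apply: H; exists r.
have [w /negP[]] := exists_notin_vline v.
have : [set: 'rV[R]_2] (p + w) by [].
rewrite -fullA => -[n [a [z [Az a1 E]]]].
have -> : w = \sum_(i < n) a i *: (z i - p).
  under eq_bigr do rewrite scalerBr.
  by rewrite sumrB -scaler_suml a1 scale1r -E addrC addKr.
by apply: memv_suml => i _; apply/memvZ/inA.
Qed.

Lemma convex_set_comb (R : realType) (V : lmodType R) (A : set V) x y (s t : R) :
  convex_set A -> A x -> A y -> 0 <= s -> 0 <= t -> s + t = 1 ->
  A (s *: x + t *: y).
Proof.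
move=> convA Ax Ay s0 t0 st.
have s1 : s <= 1 by lra.
have := convA x y (Itv01 s0 s1); rewrite !inE => /(_ Ax Ay).
by have -> : t = 1 - s by lra.
Qed.

Lemma convex_set_comb3 (R : realType) (V : lmodType R) (A : set V) x y z (s t r : R) :
  convex_set A -> A x -> A y -> A z ->
  0 < s -> 0 < t -> 0 < r -> s + t + r = 1 ->
  A (s *: x + t *: y + r *: z).
Proof.
move=> convA Ax Ay Az s0 t0 r0 str.
have st0 : 0 < s + t by lra.
have -> : s *: x + t *: y + r *: z =
    (s + t) *: ((s / (s + t)) *: x + (t / (s + t)) *: y) + r *: z.
  by rewrite scalerDr !scalerA !mulrA !(mulrC (s + t)) !mulfK// gt_eqF.
apply: convex_set_comb => //; try lra.
apply: convex_set_comb => //; rewrite ?divr_ge0 ?ltW//.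
by rewrite -mulrDl divff// gt_eqF.
Qed.

(** For a convex set of the plane this is the usual interior; testing one line
    at a time is all that the difference arguments below need. *)
Definition algebraic_interior (R : realType) (V : lmodType R) (A : set V) : set V :=
  [set w | forall v, \forall s \near (0 : R), A (w + s *: v)].

Lemma near0_line_gt0 (R : realType) (c k : R) :
  0 < c -> \forall s \near (0 : R), 0 < c + s * k.
Proof.
move=> c0.
have : (c + s * k) @[s --> (0 : R)] --> c + 0 * k.
  by apply: cvgD; [|apply: cvgM]; (exact: cvg_cst || exact: cvg_id).
rewrite mul0r addr0 => /cvgr_gt; exact.
Qed.

(** Barycentric coordinates with respect to a nondegenerate triangle move
    affinely along a line, so positive ones stay positive for a while. *)
Lemma triangle_algebraic_interior (R : realType) (A : set 'rV[R]_2) p q r (a b c : R) :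
  convex_set A -> A p -> A q -> A r -> free [:: r - p; q - p] ->
  0 < a -> 0 < b -> 0 < c -> a + b + c = 1 ->
  algebraic_interior A (a *: p + b *: q + c *: r).
Proof.
move=> convA Ap Aq Ar fr a0 b0 c0 abc v.
have [i [j ->]] := free_pair_span v fr.
near=> s.
have -> : a *: p + b *: q + c *: r + s *: (i *: (r - p) + j *: (q - p)) =
    (a + s * - (i + j)) *: p + (b + s * j) *: q + (c + s * i) *: r.
  by apply/rowP => l; rewrite !mxE; ring.
apply: convex_set_comb3 => //; [near: s..|]; try exact: near0_line_gt0.
by rewrite -abc; ring.
Unshelve. all: by end_near.
Qed.

(** * Decompositions of the points of a sum set *)

(** The situation of one of the two sets [F], [Ft], so that each argument can
    be carried out once and used with the two sets exchanged. *)
Definition additive_over_segments (R : realType) (f g h : 'rV[R]_2 -> R)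
    (F : set ('rV[R]_2 * 'rV[R]_2)) (u1 d1 u2 d2 : 'rV[R]_2) : Prop :=
  [/\ convex_set F, forall u v, F (u, v) -> f u + g v = h (u + v),
      @p1 R @` F = param_segment u1 d1, @p2 R @` F = param_segment u2 d2
    & free [:: d1; d2]].

Lemma summand1_segment (R : realType) (f g h : 'rV[R]_2 -> R)
    (F : set ('rV[R]_2 * 'rV[R]_2)) u1 d1 u2 d2 u v :
  additive_over_segments f g h F u1 d1 u2 d2 -> F (u, v) ->
  exists2 x, 0 <= x <= 1 & u = u1 + x *: d1.
Proof.
move=> [_ _ p1F _ _] Fuv.
have : (@p1 R @` F) u by exists (u, v).
by rewrite p1F => -[x x01 <-]; exists x.
Qed.

Lemma summand2_segment (R : realType) (f g h : 'rV[R]_2 -> R)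
    (F : set ('rV[R]_2 * 'rV[R]_2)) u1 d1 u2 d2 u v :
  additive_over_segments f g h F u1 d1 u2 d2 -> F (u, v) ->
  exists2 y, 0 <= y <= 1 & v = u2 + y *: d2.
Proof.
move=> [_ _ _ p2F _] Fuv.
have : (@p2 R @` F) v by exists (u, v).
by rewrite p2F => -[y y01 <-]; exists y.
Qed.

Lemma exists_summand2 (R : realType) (f g h : 'rV[R]_2 -> R)
    (F : set ('rV[R]_2 * 'rV[R]_2)) u1 d1 u2 d2 x :
  additive_over_segments f g h F u1 d1 u2 d2 -> 0 <= x <= 1 ->
  exists v, F (u1 + x *: d1, v).
Proof.
move=> [_ _ p1F _ _] x01.
have : (@p1 R @` F) (u1 + x *: d1) by rewrite p1F; exists x.
by move=> [[u v] Fuv <-]; exists v.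
Qed.

(** As [d1] and [d2] are independent, a point of [p3 F] has a unique
    decomposition in [F], and its summands follow its coordinates. *)
Lemma summands_move (R : realType) (f g h : 'rV[R]_2 -> R)
    (F : set ('rV[R]_2 * 'rV[R]_2)) u1 d1 u2 d2 u v i j :
  additive_over_segments f g h F u1 d1 u2 d2 -> F (u, v) ->
  (@p3 R @` F) (u + v + (i *: d1 + j *: d2)) ->
  F (u + i *: d1, v + j *: d2).
Proof.
move=> addF Fuv [[u' v'] Fuv' E].
have [x _ Eu] := summand1_segment addF Fuv.
have [y _ Ev] := summand2_segment addF Fuv.
have [x' _ Eu'] := summand1_segment addF Fuv'.
have [y' _ Ev'] := summand2_segment addF Fuv'.
have [_ _ _ _ fr] := addF.
have [xE yE] : x' - x - i = 0 /\ y' - y - j = 0.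
  apply: (free_pair_eq0 fr); apply/rowP => l.
  move: E; rewrite /p3 /= Eu Ev Eu' Ev' => /rowP/(_ l).
  by rewrite !mxE; lra.
suff [-> ->] : u + i *: d1 = u' /\ v + j *: d2 = v' by [].
rewrite Eu Ev Eu' Ev' (_ : x' = x + i); last lra.
by rewrite (_ : y' = y + j); [rewrite !scalerDl !addrA | lra].
Qed.

Lemma convex_p3_image (R : realType) (F : set ('rV[R]_2 * 'rV[R]_2)) :
  convex_set F -> convex_set (@p3 R @` F).
Proof.
move=> convF w1 w2 l; rewrite !inE => -[x Fx <-] [y Fy <-].
exists (conv l (x : convex_lmodType _) y).
  by have := convF x y l; rewrite !inE; apply.
by rewrite /p3 /conv /=; apply/rowP => i; rewrite !mxE; ring.
Qed.

(** Adding [s *: d1] to a point of the common sum set shifts only the first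
    summand of each of its two decompositions. Both differences of [f]
    therefore equal the same difference of [h]. *)
Lemma first_difference_transfer (R : realType) (f g h : 'rV[R]_2 -> R)
    (F Ft : set ('rV[R]_2 * 'rV[R]_2)) u1 d1 u2 d2 ut1 ut2 dt2 u v ut vt s :
  additive_over_segments f g h F u1 d1 u2 d2 ->
  additive_over_segments f g h Ft ut1 d1 ut2 dt2 ->
  @p3 R @` F = @p3 R @` Ft ->
  F (u, v) -> Ft (ut, vt) -> u + v = ut + vt ->
  (@p3 R @` F) (u + v + s *: d1) ->
  f (u + s *: d1) - f u = f (ut + s *: d1) - f ut.
Proof.
move=> addF addFt p3F Fuv Ftuv uvE Ps.
have [_ fghF _ _ _] := addF; have [_ fghFt _ _ _] := addFt.
have Fs : F (u + s *: d1, v).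
  rewrite -[v]addr0 -(scale0r d2); apply: (summands_move addF Fuv).
  by rewrite scale0r addr0.
have Fts : Ft (ut + s *: d1, vt).
  rewrite -[vt]addr0 -(scale0r dt2); apply: (summands_move addFt Ftuv).
  by rewrite scale0r addr0 -uvE -p3F.
have := fghF _ _ Fuv; have := fghF _ _ Fs.
have := fghFt _ _ Ftuv; have := fghFt _ _ Fts.
by rewrite ![_ + s *: d1 + _]addrAC uvE; lra.
Qed.

(** Write [dt2 = a *: d1 + b *: d2]; here [a != 0] because [d2] and [dt2] are
    independent. Move the sum point by [s *: e] with [e := - a^-1 *: dt2]: the
    first summand in [Ft] stays at [ut], while the first summand in [F]
    becomes [u - s *: d1]. Transferring the first difference of [f] before and
    after this move compares both [f (u + s *: d1) - f u] and
    [f u - f (u - s *: d1)] with [f (ut + s *: d1) - f ut]. *)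
Lemma second_difference_eq0 (R : realType) (f g h : 'rV[R]_2 -> R)
    (F Ft : set ('rV[R]_2 * 'rV[R]_2)) u1 d1 u2 d2 ut1 ut2 dt2 u v ut vt :
  additive_over_segments f g h F u1 d1 u2 d2 ->
  additive_over_segments f g h Ft ut1 d1 ut2 dt2 ->
  free [:: d2; dt2] ->
  @p3 R @` F = @p3 R @` Ft ->
  F (u, v) -> Ft (ut, vt) -> u + v = ut + vt ->
  algebraic_interior (@p3 R @` F) (u + v) ->
  \forall s \near (0 : R), f (u + s *: d1) + f (u - s *: d1) = 2 * f u.
Proof.
move=> addF addFt frd p3F Fuv Ftuv uvE intP.
have [_ _ _ _ fr] := addF.
have [a [b dt2E]] := free_pair_span dt2 fr.
have a0 : a != 0.
  apply/eqP => a0.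
  have [|_ /eqP] := @free_pair_eq0 R d2 dt2 b (-1) frd.
    by rewrite dt2E a0 scale0r add0r scaleN1r subrr.
  by rewrite oppr_eq0 oner_eq0.
(* normalised so that its [d1]-coordinate is [-1] *)
pose e := - a^-1 *: dt2.
have eE : e = - d1 + (- (a^-1 * b)) *: d2.
  rewrite /e dt2E scalerDr !scalerA mulNr mulVf// mulNr.
  by rewrite scaleN1r.
near=> s.
have E1 : f (u + s *: d1) - f u = f (ut + s *: d1) - f ut.
  apply: (first_difference_transfer addF addFt p3F Fuv Ftuv uvE).
  by near: s; exact: intP.
have Pe : (@p3 R @` F) (u + v + s *: e) by near: s; exact: intP.
have Pe1 : (@p3 R @` F) (u + v + s *: (e + d1)) by near: s; exact: intP.
have Fe : F (u + (- s) *: d1, v + (- (s * (a^-1 * b))) *: d2).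
  apply: (summands_move addF Fuv).
  move: Pe; congr (_ _); rewrite eE scalerDr scalerA scalerN scaleNr.
  by rewrite mulrN.
have Fte : Ft (ut + 0 *: d1, vt + (- (s * a^-1)) *: dt2).
  apply: (summands_move addFt Ftuv).
  rewrite -p3F -uvE; move: Pe; congr (_ _).
  by rewrite /e scale0r add0r scalerA mulrN.
have sumE : u + (- s) *: d1 + (v + (- (s * (a^-1 * b))) *: d2) =
    u + v + s *: e.
  by apply/rowP => l; rewrite eE !mxE; ring.
have E2 : f u - f (u - s *: d1) = f (ut + s *: d1) - f ut.
  have := first_difference_transfer (s := s) addF addFt p3F Fe Fte.
  rewrite scale0r addr0 sumE !scaleNr subrK; apply.
    by rewrite uvE /e scalerA mulrN scaleNr addrA.
  by move: Pe1; rewrite scalerDr addrA.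
lra.
Unshelve. all: by end_near.
Qed.

(** Take points of [p3 F] lying over the two ends of the first segment and a
    third one off the line through them; a positive combination of the three
    lies over the prescribed point of the segment. *)
Lemma exists_interior_over (R : realType) (f g h : 'rV[R]_2 -> R)
    (F : set ('rV[R]_2 * 'rV[R]_2)) u1 d1 u2 d2 x :
  additive_over_segments f g h F u1 d1 u2 d2 ->
  full_dimensional (@p3 R @` F) -> 0 < x < 1 ->
  exists2 v, F (u1 + x *: d1, v) &
    algebraic_interior (@p3 R @` F) (u1 + x *: d1 + v).
Proof.
move=> addF fullF /andP[x0 x1].
have [convF _ _ _ fr] := addF.
have [v0 F0] : exists v, F (u1 + 0 *: d1, v).
  by apply: (exists_summand2 addF); rewrite lexx ler01.
have [v1 F1] : exists v, F (u1 + 1 *: d1, v).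
  by apply: (exists_summand2 addF); rewrite lexx ler01.
rewrite scale0r addr0 in F0; rewrite scale1r in F1.
pose p := u1 + v0; pose q := u1 + d1 + v1.
have [r [[ur vr] Fr rE] pqr] :=
  full_dimensional_escapes_line p (q - p) fullF.
have [y0 _ v0E] := summand2_segment addF F0.
have [y1 _ v1E] := summand2_segment addF F1.
have [z /andP[z0 z1] urE] := summand1_segment addF Fr.
have qp : q - p != 0.
  apply/eqP => qp; have [|/eqP] := @free_pair_eq0 R d1 d2 1 (y1 - y0) fr.
    rewrite -qp /q /p v0E v1E.
    by apply/rowP => l; rewrite !mxE; ring.
  by rewrite oner_eq0.
(* [c] is the weight of [r]; [b] and [a] are then forced by the abscissa [x],
   and this [c] is small enough for both to be positive *)
pose c := x * (1 - x); pose b := x - c * z; pose a := 1 - b - c.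
have c0 : 0 < c by rewrite mulr_gt0// subr_gt0.
have b0 : 0 < b.
  rewrite (_ : b = x ^+ 2 + c * (1 - z)); last by rewrite /b /c; ring.
  by rewrite ltr_wpDr ?exprn_gt0// mulr_ge0 ?subr_ge0// ltW.
have a0 : 0 < a.
  rewrite (_ : a = (1 - x) ^+ 2 + c * z); last by rewrite /a /b /c; ring.
  by rewrite ltr_wpDr ?exprn_gt0 ?subr_gt0// mulr_ge0// ltW.
have abc : a + b + c = 1 by rewrite /a; ring.
pose v := a *: v0 + b *: v1 + c *: vr.
have wE : u1 + x *: d1 + v = a *: p + b *: q + c *: r.
  rewrite -rE /p3 /= urE /p /q /v.
  by apply/rowP => l; rewrite !mxE /a /b; ring.
exists v.
  have := convex_set_comb3 convF F0 F1 Fr a0 b0 c0 abc.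
  congr (F (_, _)); rewrite urE.
  by apply/rowP => l; rewrite !mxE /a /b; ring.
rewrite wE; apply: triangle_algebraic_interior => //.
- exact: convex_p3_image.
- by exists (u1, v0).
- by exists (u1 + d1, v1).
- by exists (ur, vr).
- by rewrite free_pair pqr.
Qed.

Lemma affine_on_summand1 (R : realType) (f g h : 'rV[R]_2 -> R)
    (F Ft : set ('rV[R]_2 * 'rV[R]_2)) u1 d1 u2 d2 ut1 ut2 dt2 x :
  continuous f ->
  additive_over_segments f g h F u1 d1 u2 d2 ->
  additive_over_segments f g h Ft ut1 d1 ut2 dt2 ->
  free [:: d2; dt2] ->
  @p3 R @` F = @p3 R @` Ft -> full_dimensional (@p3 R @` F) ->
  0 <= x <= 1 ->
  f (u1 + x *: d1) = f u1 + x * (f (u1 + d1) - f u1).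
Proof.
move=> cf addF addFt frd p3F fullF x01.
pose phi y := f (u1 + y *: d1).
have cphi : continuous phi.
  move=> y; apply: continuous_comp; last exact: cf.
  apply: cvgD; first exact: cvg_cst.
  by apply: cvgZr_tmp; exact: cvg_id.
have phiE y : 0 < y < 1 ->
    \forall s \near (0 : R), phi (y + s) + phi (y - s) = 2 * phi y.
  move=> y01.
  have [v Fv intP] := exists_interior_over addF fullF y01.
  have : (@p3 R @` F) (u1 + y *: d1 + v) by exists (u1 + y *: d1, v).
  rewrite p3F => -[[ut vt] Ftuv E].
  have := second_difference_eq0 addF addFt frd p3F Fv Ftuv (esym E) intP.
  apply: filterS => s; rewrite /phi scalerDl scalerBl !addrA; exact.
have := affine_of_locally_vanishing_second_difference ltr01 cphi phiE x01.
by rewrite /phi scale0r addr0 scale1r !subr0 divr1 mulrC.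
Qed.

Lemma first_difference_on_segment (R : realType) (f g h : 'rV[R]_2 -> R)
    (F Ft : set ('rV[R]_2 * 'rV[R]_2)) u1 d1 u2 d2 ut1 ut2 dt2 u t :
  continuous f ->
  additive_over_segments f g h F u1 d1 u2 d2 ->
  additive_over_segments f g h Ft ut1 d1 ut2 dt2 ->
  free [:: d2; dt2] ->
  @p3 R @` F = @p3 R @` Ft -> full_dimensional (@p3 R @` F) ->
  param_segment u1 d1 u -> param_segment u1 d1 (u + t *: d1) ->
  f (u + t *: d1) - f u = t * (f (u1 + d1) - f u1).
Proof.
move=> cf addF addFt frd p3F fullF [x x01 <-] [y y01 E].
have [_ _ _ _ fr] := addF.
have [yE _] : y - x - t = 0 /\ 0 = 0 :> R.
  apply: (free_pair_eq0 fr); apply/rowP => l.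
  by move: E => /rowP/(_ l); rewrite !mxE; lra.
have fE := affine_on_summand1 cf addF addFt frd p3F fullF.
rewrite -E !fE// (_ : y = x + t); last lra.
by ring.
Qed.

(** At a sum point in the interior, the transferred first difference of [f]
    along [d1] is computed on each of the two segments. *)
Lemma slopes_agree (R : realType) (f g h : 'rV[R]_2 -> R)
    (F Ft : set ('rV[R]_2 * 'rV[R]_2)) u1 d1 u2 d2 ut1 ut2 dt2 :
  continuous f ->
  additive_over_segments f g h F u1 d1 u2 d2 ->
  additive_over_segments f g h Ft ut1 d1 ut2 dt2 ->
  free [:: d2; dt2] ->
  @p3 R @` F = @p3 R @` Ft -> full_dimensional (@p3 R @` F) ->
  f (u1 + d1) - f u1 = f (ut1 + d1) - f ut1.
Proof.
move=> cf addF addFt frd p3F fullF.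
have frd' : free [:: dt2; d2].
  by rewrite (perm_free (permEl (perm_catC [:: dt2] [:: d2]))).
have half01 : 0 < (2^-1 : R) < 1.
  by rewrite invr_gt0 invf_lt1 ?ltr0n// ltr1n.
have [v Fuv intP] := exists_interior_over addF fullF half01.
set u := u1 + _ in Fuv intP.
have : (@p3 R @` F) (u + v) by exists (u, v).
rewrite p3F => -[[ut vt] Ftuv uvE].
have [s s0 Ps] : exists2 s : R, s != 0 & (@p3 R @` F) (u + v + s *: d1).
  have nearP : \forall s \near (0 : R)^',
      s != 0 /\ (@p3 R @` F) (u + v + s *: d1).
    near=> s; split; first by near: s; exact: nbhs_dnbhs_neq.
    by near: s; apply: nbhs_dnbhs; exact: intP.
  by have [s [s0 Ps]] := filter_ex nearP; exists s.
have seg1 G e1 e2 f2 a b : additive_over_segments f g h G e1 d1 e2 f2 ->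
    G (a, b) -> param_segment e1 d1 a.
  by move=> [_ _ <- _ _] Gab; exists (a, b).
have Fs : F (u + s *: d1, v + 0 *: d2).
  by apply: (summands_move addF Fuv); rewrite scale0r addr0.
have Fts : Ft (ut + s *: d1, vt + 0 *: dt2).
  apply: (summands_move addFt Ftuv).
  by rewrite scale0r addr0 -p3F -[ut + vt]/(p3 (ut, vt)) uvE.
have E1 := first_difference_on_segment cf addF addFt frd p3F fullF
  (seg1 _ _ _ _ _ _ addF Fuv) (seg1 _ _ _ _ _ _ addF Fs).
have fullFt : full_dimensional (@p3 R @` Ft) by rewrite -p3F.
have E2 := first_difference_on_segment cf addFt addF frd' (esym p3F) fullFt
  (seg1 _ _ _ _ _ _ addFt Ftuv) (seg1 _ _ _ _ _ _ addFt Fts).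
apply: (mulfI s0); rewrite -E1 -E2.
exact: (first_difference_transfer addF addFt p3F Fuv Ftuv (esym uvE)).
Unshelve. all: by end_near.
Qed.

(** Once the slope [dotv c d1] of [f] along the first segment is known, the
    rest follows: [p2 F] meets every translate of the line spanned by [d1] in
    at most one point, and [h] varies like [f] along such a line. *)
Lemma affine_wrt_summands (R : realType) (f g h : 'rV[R]_2 -> R)
    (F : set ('rV[R]_2 * 'rV[R]_2)) u1 d1 u2 d2 c :
  additive_over_segments f g h F u1 d1 u2 d2 ->
  (forall u t, param_segment u1 d1 u -> param_segment u1 d1 (u + t *: d1) ->
     f (u + t *: d1) - f u = t * dotv c d1) ->
  [/\ affine_wrt <[d1]>%VS (@p1 R @` F) f c,
      affine_wrt <[d1]>%VS (@p2 R @` F) g c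
    & affine_wrt <[d1]>%VS (@p3 R @` F) h c].
Proof.
move=> addF slope.
have dotvZ t : dotv c (t *: d1) = t * dotv c d1.
  by rewrite /dotv mulr_sumr; apply: eq_bigr => i _; rewrite mxE; ring.
have [_ fgh p1F p2F fr] := addF.
have moved w1 w2 : w2 - w1 \in <[d1]>%VS -> exists t, w2 = w1 + t *: d1.
  by move=> /vlineP[t E]; exists t; rewrite -E addrC subrK.
split.
- move=> w1 w2 Fw1 Fw2 /moved[t wE]; rewrite p1F in Fw1 Fw2.
  by rewrite wE in Fw2 *; rewrite slope// addrAC subrr add0r dotvZ.
- rewrite p2F => w1 w2 [x _ <-] [y _ <-] /moved[t].
  move=> /rowP E.
  have [t0 _] : t = 0 /\ x - y = 0.
    apply: (free_pair_eq0 fr); apply/rowP => l.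
    by move: (E l); rewrite !mxE; lra.
  have -> : u2 + y *: d2 = u2 + x *: d2 + t *: d1 by apply/rowP.
  by rewrite t0 scale0r addr0 !subrr -[X in dotv c X](scale0r d1) dotvZ mul0r.
- move=> _ w2 [[u v] Fuv <-] Fw2 /moved[t wE]; rewrite wE in Fw2 *.
  have Ft : F (u + t *: d1, v + 0 *: d2).
    by apply: (summands_move addF Fuv); rewrite scale0r addr0.
  have segF a b : F (a, b) -> param_segment u1 d1 a.
    by rewrite -p1F => Fab; exists (a, b).
  have := slope u t (segF _ _ Fuv) (segF _ _ Ft).
  have := fgh _ _ Fuv; have := fgh _ _ Ft.
  rewrite scale0r addr0 /p3 /= [_ + t *: d1 + v]addrAC => <- <- fE.
  by rewrite [u + v + _]addrC addrK dotvZ -fE; ring.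
Qed.

Theorem lemma4p2 (R : realType) (f g h : 'rV[R]_2 -> R)
  (cf : continuous f) (cg : continuous g) (ch : continuous h)
  (F Ft : set ('rV[R]_2 * 'rV[R]_2))
  (convF : convex_set F) (convFt : convex_set Ft)
  (fgh : forall u v : 'rV[R]_2, (F `|` Ft) (u, v) -> f u + g v = h (u + v))
  (p3F : @p3 R @` F = @p3 R @` Ft)
  (fullF : full_dimensional (@p3 R @` F))
  (u1 u2 d1 d2 ut1 ut2 dt1 dt2 : 'rV[R]_2)
  (p1F : @p1 R @` F = param_segment u1 d1)
  (p2F : @p2 R @` F = param_segment u2 d2)
  (p1Ft : @p1 R @` Ft = param_segment ut1 dt1)
  (p2Ft : @p2 R @` Ft = param_segment ut2 dt2)
  (d1E : d1 = dt1)
  (free_d1_d2 : free [:: d1; d2])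
  (free_d1_dt2 : free [:: d1; dt2])
  (free_d2_dt2 : free [:: d2; dt2]) :
  exists c : 'rV[R]_2,
    [/\ affine_wrt <[d1]>%VS (@p1 R @` F) f c /\
        affine_wrt <[d1]>%VS (@p1 R @` Ft) f c,
        affine_wrt <[d1]>%VS (@p2 R @` F) g c /\
        affine_wrt <[d1]>%VS (@p2 R @` Ft) g c
      & affine_wrt <[d1]>%VS (@p3 R @` F) h c /\
        affine_wrt <[d1]>%VS (@p3 R @` Ft) h c].
Proof.
subst dt1.
have addF : additive_over_segments f g h F u1 d1 u2 d2.
  by split=> // u v Fuv; apply: fgh; left.
have addFt : additive_over_segments f g h Ft ut1 d1 ut2 dt2.
  by split=> // u v Fuv; apply: fgh; right.
have fullFt : full_dimensional (@p3 R @` Ft) by rewrite -p3F.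
have free_dt2_d2 : free [:: dt2; d2].
  by rewrite (perm_free (permEl (perm_catC [:: dt2] [:: d2]))).
have kE := slopes_agree cf addF addFt free_d2_dt2 p3F fullF.
pose k := f (u1 + d1) - f u1.
have d1_neq0 : dotv d1 d1 != 0.
  apply/eqP => d10; have [|/eqP] := @free_pair_eq0 R d1 d2 1 0 free_d1_d2.
    rewrite scale1r scale0r addr0; apply/rowP => i; rewrite mxE; apply/eqP.
    have sq j : true -> 0 <= d1 0 j * d1 0 j by rewrite -expr2 sqr_ge0.
    move/eqP: d10; rewrite /dotv psumr_eq0// => /allP/(_ i).
    by rewrite mem_index_enum mulf_eq0 orbb; apply.
  by rewrite oner_eq0.
pose c := (k / dotv d1 d1) *: d1.
have cE : dotv c d1 = k.
  rewrite -[RHS](divfK d1_neq0) /c {1 4}/dotv mulr_sumr.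
  by apply: eq_bigr => i _; rewrite mxE mulrA.
have [fF gF hF] : [/\ affine_wrt <[d1]>%VS (@p1 R @` F) f c,
    affine_wrt <[d1]>%VS (@p2 R @` F) g c
  & affine_wrt <[d1]>%VS (@p3 R @` F) h c].
  apply: (affine_wrt_summands addF) => u t; rewrite cE.
  exact: (first_difference_on_segment cf addF addFt).
have [fFt gFt hFt] : [/\ affine_wrt <[d1]>%VS (@p1 R @` Ft) f c,
    affine_wrt <[d1]>%VS (@p2 R @` Ft) g c
  & affine_wrt <[d1]>%VS (@p3 R @` Ft) h c].
  apply: (affine_wrt_summands addFt) => u t; rewrite cE /k kE.
  exact: (first_difference_on_segment cf addFt addF).
by exists c; split; split.
Qed.
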